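(* For every real number $q$ with $-1<q<1$, the $C^*$-algebras $\mathcal{O}_2^q$ and $\mathcal{O}_2^0$ are isomorphic (as $C^*$-algebras): $\mathcal{O}_2^q\simeq\mathcal{O}_2^0$.
   Context: For $|q|<1$, $\mathcal{O}_2^q$ denotes the universal unital $C^*$-algebra generated by two isometries $s_1,s_2$ (i.e. $s_1^*s_1=s_2^*s_2=1$) satisfying the relation $s_1^*s_2=q\,s_2s_1^*$. For $q=0$ this is the Cuntz-Toeplitz $C^*$-algebra $\mathcal{O}_2^0$, the universal unital $C^*$-algebra generated by isometries $t_1,t_2$ with $t_1^*t_2=0$. *)

(* Defs.v *)
From HB Require Import structures.
From mathcomp Require Import all_boot all_order all_algebra.
From mathcomp Require Import all_classical all_reals all_analysis.
From mathcomp Require Import complex.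

Set Implicit Arguments.
Unset Strict Implicit.
Unset Printing Implicit Defensive.

Import Order.TTheory GRing.Theory Num.Theory.
Import numFieldNormedType.Exports.

Local Open Scope classical_set_scope.
Local Open Scope ring_scope.

(* The norm is a separate operation cnorm because normedModType and algType
   have no join: HB identifies the join of normed Z-modules and rings with
   numDomainType. *)
HB.mixin Record Algebra_isCstarAlgebra (R : realType) A
    & GRing.Algebra R[i] A := {
  star : A -> A;
  starK : involutive star;
  starD : forall x y : A, star (x + y) = star x + star y;
  starZ : forall (c : R[i]) (x : A), star (c *: x) = c^* *: star x;
  starM : forall x y : A, star (x * y) = star y * star x;
  cnorm : A -> R;
  cnorm_eq0 : forall x : A, cnorm x = 0 -> x = 0;
  cnormD_le : forall x y : A, cnorm (x + y) <= cnorm x + cnorm y;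
  cnormZ : forall (c : R[i]) (x : A), cnorm (c *: x) = complex.Re `|c| * cnorm x;
  cnormM_le : forall x y : A, cnorm (x * y) <= cnorm x * cnorm y;
  cnorm_starM : forall x : A, cnorm (star x * x) = cnorm x ^+ 2;
  cnorm_complete : forall u : nat -> A,
    (forall e : R, 0 < e -> exists N : nat, forall m n : nat,
       (N <= m)%N -> (N <= n)%N -> cnorm (u m - u n) < e) ->
    exists l : A, cnorm (u n - l) @[n --> \oo] --> (0 : R)
}.

#[short(type="cstarAlgType")]
HB.structure Definition CstarAlgebra (R : realType) :=
  {A of GRing.Algebra R[i] A & Algebra_isCstarAlgebra R A}.

Definition is_starhom (R : realType) (A B : cstarAlgType R)
    (f : {lrmorphism A -> B}) : Prop :=
  forall x : A, f (star x) = star (f x).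

Definition cstar_isomorphic (R : realType) (A B : cstarAlgType R) : Prop :=
  exists f : {lrmorphism A -> B}, is_starhom f /\ bijective f.

Definition cnorm_closed (R : realType) (A : cstarAlgType R) (S : set A)
    : Prop :=
  forall (u : nat -> A) (l : A), (forall n, S (u n)) ->
    cnorm (u n - l) @[n --> \oo] --> (0 : R) -> S l.

Definition generates_cstar (R : realType) (A : cstarAlgType R) (G : set A)
    : Prop :=
  forall S : set A, cnorm_closed S -> G `<=` S -> S 1 ->
    (forall x y, S x -> S y -> S (x + y)) ->
    (forall (c : R[i]) x, S x -> S (c *: x)) ->
    (forall x y, S x -> S y -> S (x * y)) ->
    (forall x, S x -> S (star x)) ->
    S = setT.

Definition O2q_relations (R : realType) (q : R) (A : cstarAlgType R)
    (s1 s2 : A) : Prop :=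
  [/\ star s1 * s1 = 1, star s2 * s2 = 1
    & star s1 * s2 = q%:C%C *: (s2 * star s1)].

(* (A, s1, s2) is a model of the universal unital C*-algebra O_2^q; such a
   model is unique up to an isomorphism preserving the generators.  All
   C*-algebras here are nonzero, as algType requires 1 != 0. *)
Definition is_O2q (R : realType) (q : R) (A : cstarAlgType R) (s1 s2 : A)
    : Prop :=
  [/\ O2q_relations q s1 s2,
      generates_cstar [set s1; s2]
    & forall (B : cstarAlgType R) (b1 b2 : B), O2q_relations q b1 b2 ->
        exists f : {lrmorphism A -> B},
          [/\ is_starhom f, f s1 = b1 & f s2 = b2] /\
          forall g : {lrmorphism A -> B},
            [/\ is_starhom g, g s1 = b1 & g s2 = b2] -> g =1 f].

(* Main.v *)
Require Import Defs.
From mathcomp Require Import all_boot all_order all_algebra.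
From mathcomp Require Import all_classical all_reals all_analysis.
From mathcomp Require Import complex ring lra.

Import Order.TTheory GRing.Theory Num.Theory.
Import numFieldNormedType.Exports.

Local Open Scope ring_scope.

(** In O_2^q put P = s1 s1^*.  Since s2^* (1 - P) s2 = 1 - q^2 P is invertible,
    t2 = (1 - P) s2 (1 - q^2 P)^(-1/2) is an isometry with s1^* t2 = 0.
    Conversely s2 is recovered from s1 and t2 as the unique solution of
    x = t2 (1 - q^2 P)^(1/2) + q s1 x s1^*, the right-hand side being a
    contraction in x. *)

Section CstarTheory.
Context {R : realType} {A : cstarAlgType R}.
Implicit Types (x y t : A) (c d : R).

Lemma star1 : star (1 : A) = 1.
Proof. by rewrite -[LHS]mul1r -{1}(starK (1 : A)) -starM mul1r starK. Qed.

Lemma star0 : star (0 : A) = 0.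
Proof. by rewrite -(scale0r (0 : A)) starZ conjC0 !scale0r. Qed.

Lemma starZr c x : star (c%:C%C *: x) = c%:C%C *: star x.
Proof. by rewrite starZ conj_Creal // complex_real. Qed.

Lemma cnormZr c x : cnorm (c%:C%C *: x) = `|c| * cnorm x.
Proof. by rewrite cnormZ normc_def /= expr0n addr0 sqrtr_sqr. Qed.

Lemma cnorm0 : cnorm (0 : A) = 0.
Proof. by rewrite -(scale0r (0 : A)) (cnormZr 0) normr0 mul0r. Qed.

Lemma cnormN x : cnorm (- x) = cnorm x.
Proof. by rewrite -scaleN1r -(rmorphN1 (real_complex R)) cnormZr normrN1 mul1r. Qed.

Lemma cnorm_ge0 x : 0 <= cnorm x.
Proof. by have := cnormD_le x (- x); rewrite subrr cnorm0 cnormN; lra. Qed.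

Lemma cnorm_star x : cnorm (star x) = cnorm x.
Proof.
suff le_star y : cnorm y <= cnorm (star y).
  by apply/le_anti; rewrite le_star -{2}(starK x) le_star.
have := cnormM_le (star y) y; rewrite cnorm_starM expr2.
have [->|y0] := eqVneq (cnorm y) 0; first by rewrite cnorm_ge0.
by rewrite ler_pM2r // lt_def y0 cnorm_ge0.
Qed.

Lemma isometry_cnorm_le1 t : star t * t = 1 -> cnorm t <= 1.
Proof.
have norm1 : cnorm (1 : A) <= 1.
  have := cnorm_starM (1 : A); rewrite star1 mulr1 => e.
  have := cnorm_ge0 (1 : A); nra.
move=> tt; have := cnorm_starM t; rewrite tt => e.
have := cnorm_ge0 t; nra.
Qed.

Lemma cnorm_conj_le t x : star t * t = 1 -> cnorm (t * x * star t) <= cnorm x.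
Proof.
move=> /isometry_cnorm_le1 t1; have t0 := cnorm_ge0 t; have x0 := cnorm_ge0 x.
apply: (le_trans (cnormM_le _ _)); rewrite cnorm_star.
have := cnormM_le t x; have := cnorm_ge0 (t * x); nra.
Qed.

(** Compression by an isometry does not increase the norm, so [cnorm x] is at most [|c|] times
    itself. Applied to a difference, this gives uniqueness for the twisted fixed-point equation. *)
Lemma twist_eq0 c t x : `|c| < 1 -> star t * t = 1 ->
  x = c%:C%C *: (t * x * star t) -> x = 0.
Proof.
move=> c1 tt xE; apply: cnorm_eq0.
have := cnorm_ge0 x; have := cnorm_conj_le t x tt.
have := congr1 cnorm xE; rewrite cnormZr.
have := normr_ge0 c; nra.
Qed.

(** Banach's fixed-point argument for [cnorm], iterating from 0. *)
Lemma cnorm_contraction_fixpoint (k : R) (T : A -> A) : 0 <= k < 1 ->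
  (forall x y, cnorm (T x - T y) <= k * cnorm (x - y)) -> exists x, x = T x.
Proof.
move=> /andP[k0 k1] Tk; pose u n := iter n T 0.
(* [C] is the sum of the geometric series of steps: [cnorm (T 0) + k * C = C], so [T] preserves the
   ball of radius [C]. *)
pose C := cnorm (T 0) / (1 - k).
have k1' : 0 < 1 - k by lra.
have C0 : 0 <= C by rewrite divr_ge0 ?cnorm_ge0 ?ltW.
have CE : cnorm (T 0) = C - k * C by rewrite /C; field; lra.
have uC p : cnorm (u p) <= C.
  elim: p => [|p IH]; first by rewrite cnorm0.
  have := cnormD_le (T (u p) - T 0) (T 0); rewrite subrK CE.
  have := Tk (u p) 0; rewrite subr0 /= -/(u p); nra.
have uD n p : cnorm (u (n + p)%N - u n) <= k ^+ n * C.
  elim: n => [|n IH]; first by rewrite add0n subr0 expr0 mul1r.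
  rewrite addSn /= (le_trans (Tk _ _)) // exprS -mulrA ler_wpM2l //.
have uS m n : (n <= m)%N -> cnorm (u m - u n) <= k ^+ n * C.
  by move=> nm; rewrite -(subnKC nm).
have kC : ((k ^+ n * C) @[n --> \oo] --> (0 : R))%classic.
  rewrite -[X in (_ --> X)%classic](mul0r C); apply: cvgMl; apply: cvg_expr.
  by rewrite ger0_norm.
have [e e0|l ul] := cnorm_complete u.
  have /cvgrPdist_lt/(_ _ e0)[N _ NP] := kC.
  have kN n : (N <= n)%N -> k ^+ n * C < e.
    by move=> /NP /=; rewrite sub0r normrN ger0_norm // mulr_ge0 ?exprn_ge0.
  exists N => m n Nm Nn; have [mn|/ltnW nm] := leqP m n.
    by rewrite -opprB cnormN (le_lt_trans (uS _ _ mn)) ?kN.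
  by rewrite (le_lt_trans (uS _ _ nm)) ?kN.
exists l; apply/eqP; rewrite -subr_eq0; apply/eqP/cnorm_eq0.
(* Pass from [l] to [T l] through [u N.+1 = T (u N)]; each of the two distances is below [e / 2] for
   large [N]. *)
apply/le_anti; rewrite cnorm_ge0 andbT; apply/ler_addgt0Pr => e e0; rewrite add0r.
have /cvgrPdist_lt/(_ _ (divr_gt0 e0 (ltr0n _ 2)))[N _ NP] := ul.
have uN n : (N <= n)%N -> cnorm (u n - l) < e / 2.
  by move=> /NP /=; rewrite sub0r normrN ger0_norm ?cnorm_ge0.
have := uN N (leqnn N); have := uN N.+1 (leqnSn N) => /=.
have := cnormD_le (l - u N.+1) (u N.+1 - T l).
rewrite addrA subrK -(cnormN (l - _)) opprB /=.
have := Tk (u N) l; have := cnorm_ge0 (u N - l); nra.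
Qed.

Lemma twist_fixpoint c t y : `|c| < 1 -> star t * t = 1 ->
  exists x, x = y + c%:C%C *: (t * x * star t).
Proof.
move=> c1 tt; apply: (@cnorm_contraction_fixpoint `|c|); first by rewrite normr_ge0.
move=> x x'; rewrite opprD addrACA subrr add0r -scalerBr -mulrBl -mulrBr cnormZr.
by rewrite ler_wpM2l ?normr_ge0 // cnorm_conj_le.
Qed.

(* Multiplication by c on the range of the isometry t, and by 1 on its
   orthogonal complement. *)
Definition range_scale t c : A := 1 + (c - 1)%:C%C *: (t * star t).

Lemma range_scale1 t : range_scale t 1 = 1.
Proof. by rewrite /range_scale subrr scale0r addr0. Qed.

Lemma star_range_scale t c : star (range_scale t c) = range_scale t c.
Proof. by rewrite /range_scale starD star1 starZr starM starK. Qed.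

Lemma mul_star_range_scale t c : star t * t = 1 ->
  star t * range_scale t c = c%:C%C *: star t.
Proof.
move=> tt; rewrite mulrDr mulr1 -scalerAr mulrA tt mul1r.
by rewrite -{1}[star t]scale1r -scalerDl rmorphB rmorph1 addrC subrK.
Qed.

(** Functional calculus of the projection [t * star t]: roots and inverses reduce to those of the
    scalar. *)
Lemma range_scaleM t c d : star t * t = 1 ->
  range_scale t c * range_scale t d = range_scale t (c * d).
Proof.
move=> tt; rewrite {1}/range_scale mulrDl mul1r -scalerAl -mulrA.
rewrite mul_star_range_scale // -scalerAr scalerA /range_scale -addrA -scalerDl.
by rewrite -rmorphM -rmorphD; congr (1 + _%:C%C *: _); ring.
Qed.

End CstarTheory.

Section TwistedPair.
Context {R : realType} (q : R) (hq : -1 < q < 1).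

(** By [range_scaleM], [range_scale s1 defect] is the square root of 1 - q^2 P, and [defect^-1]
    gives its inverse. *)
Definition defect : R := Num.sqrt (1 - q ^+ 2).

Lemma defect_neq0 : defect != 0.
Proof. by case/andP: hq => ? ?; rewrite gt_eqF // sqrtr_gt0; nra. Qed.

Lemma sqr_defect : defect * defect = 1 - q ^+ 2.
Proof. by case/andP: hq => ? ?; rewrite -expr2 sqr_sqrtr //; nra. Qed.

Lemma normr_q_lt1 : `|q| < 1.
Proof. by rewrite ltr_norml. Qed.

Definition untwist {A : cstarAlgType R} (s1 s2 : A) : A :=
  range_scale s1 0 * s2 * range_scale s1 defect^-1.

Lemma untwist_relations {A : cstarAlgType R} (s1 s2 : A) :
  O2q_relations q s1 s2 -> O2q_relations 0 s1 (untwist s1 s2).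
Proof.
case=> s11 s22 s12.
(* The first factor is 1 - P. Using the twisted relation on both sides of P, [star s2] P [s2]
   becomes q^2 [s1 * star s2 * s2 * star s1], which is q^2 P. *)
have E0 : star s2 * range_scale s1 0 * s2 = range_scale s1 (defect * defect).
  rewrite {1}/range_scale mulrDr mulr1 mulrDl s22 -scalerAr -scalerAl.
  rewrite -!mulrA s12 mulrA -{1}(starK s1) -starM s12 starZr starM starK.
  rewrite -scalerAr -!scalerAl !scalerA mulrA -(mulrA _ (star s2)) s22 mulr1.
  rewrite /range_scale sqr_defect -!rmorphM; congr (1 + _%:C%C *: _); ring.
split=> //; rewrite /untwist.
  rewrite !starM !star_range_scale !mulrA.
  rewrite -(mulrA _ (range_scale s1 0) (range_scale s1 0)).
  rewrite range_scaleM // mul0r -(mulrA _ (star s2)) -(mulrA _ _ s2) E0.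
  rewrite !range_scaleM // mulrA mulVf ?defect_neq0 // mul1r.
  by rewrite mulfV ?defect_neq0 // range_scale1.
by rewrite !mulrA mul_star_range_scale // rmorph0 !scale0r !mul0r.
Qed.

(** Split [s2] as (1 - P) [s2] + P [s2]: the square roots cancel in the first term, and the twisted
    relation rewrites the second. *)
Lemma untwist_fixpoint {A : cstarAlgType R} (s1 s2 : A) :
  O2q_relations q s1 s2 ->
  s2 = untwist s1 s2 * range_scale s1 defect + q%:C%C *: (s1 * s2 * star s1).
Proof.
case=> s11 s22 s12; rewrite -!mulrA range_scaleM // mulVf ?defect_neq0 //.
rewrite range_scale1 mulr1 mulrDl mul1r sub0r rmorphN1 scaleN1r mulNr.
by rewrite -mulrA s12 -scalerAr subrK.
Qed.

Lemma twist_star {A : cstarAlgType R} (t1 t2 x : A) : O2q_relations 0 t1 t2 ->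
  x = t2 * range_scale t1 defect + q%:C%C *: (t1 * x * star t1) ->
  star t1 * x = q%:C%C *: (x * star t1).
Proof.
case=> t11 t22; rewrite rmorph0 scale0r => t12 {1}->.
by rewrite mulrDr mulrA t12 mul0r add0r -scalerAr !mulrA t11 mul1r.
Qed.

(** By [twist_star], removing from [x] its part in the range of [t1] subtracts exactly the twisted
    term, leaving [t2 * range_scale t1 defect]. *)
Lemma untwist_twist {A : cstarAlgType R} (t1 t2 x : A) : O2q_relations 0 t1 t2 ->
  x = t2 * range_scale t1 defect + q%:C%C *: (t1 * x * star t1) ->
  untwist t1 x = t2.
Proof.
move=> ht xE; have tx := twist_star _ _ _ ht xE; case: ht => t11 _ _.
rewrite /untwist {1}/range_scale sub0r rmorphN1 scaleN1r mulrDl mul1r mulNr.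
rewrite -mulrA tx -scalerAr mulrA {1}xE addrK -mulrA range_scaleM //.
by rewrite mulfV ?defect_neq0 // range_scale1 mulr1.
Qed.

(** The commutation relation is [twist_star]. For the isometry relation, [star x * x] and 1 solve
    the same contraction equation, now with factor [q ^+ 2]. *)
Lemma twist_relations {A : cstarAlgType R} (t1 t2 x : A) :
  O2q_relations 0 t1 t2 ->
  x = t2 * range_scale t1 defect + q%:C%C *: (t1 * x * star t1) ->
  O2q_relations q t1 x.
Proof.
move=> ht xE; have tx := twist_star _ _ _ ht xE; case: (ht) => t11 t22.
rewrite rmorph0 scale0r => t12; split => //.
have t21 : star t2 * t1 = 0 by rewrite -(starK t1) -starM t12 star0.
set r := t2 * _ in xE.
have rr : star r * r = range_scale t1 (1 - q ^+ 2).
  rewrite starM star_range_scale -mulrA (mulrA (star t2)) t22 mul1r.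
  by rewrite range_scaleM // sqr_defect.
(* The twisted part of [x] starts with [t1], which [star t2] kills. *)
have rx : star r * x = range_scale t1 (1 - q ^+ 2).
  rewrite {1}xE mulrDr rr -scalerAr !mulrA /r starM -(mulrA _ _ t1) t21.
  by rewrite mulr0 !mul0r scaler0 addr0.
apply/eqP; rewrite -subr_eq0; apply/eqP.
apply: (@twist_eq0 _ _ (q ^+ 2) t1) => //.
  by rewrite normrX expr_lt1 ?normr_q_lt1.
rewrite {1}xE starD mulrDl rx starZr !starM starK -scalerAl -!mulrA tx.
rewrite -!scalerAr scalerA -rmorphM -expr2 mulrBl mulrBr mul1r scalerBr !mulrA.
rewrite /range_scale -[1 + _ + _]addrA addrAC subrr add0r addrC; congr (_ + _).
by rewrite -scaleNr -rmorphN; congr (_%:C%C *: _); ring.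
Qed.

End TwistedPair.

(** Both [h] and the identity solve the universal problem for the pair [s1], [s2] itself. *)
Lemma O2q_endo_id {R : realType} (q : R) {A : cstarAlgType R} (s1 s2 : A) :
  is_O2q q s1 s2 -> forall h : {lrmorphism A -> A},
  is_starhom h -> h s1 = s1 -> h s2 = s2 -> h =1 id.
Proof.
case=> rel _ univ h hs h1 h2 a; have [k [_ kP]] := univ A s1 s2 rel.
by rewrite (kP h) //; apply/esym/(kP idfun).
Qed.

Theorem theorem1 (R : realType) (q : R) (hq : -1 < q < 1)
    (A : cstarAlgType R) (s1 s2 : A) (hA : is_O2q q s1 s2)
    (B : cstarAlgType R) (t1 t2 : B) (hB : is_O2q 0 t1 t2) :
  cstar_isomorphic A B.
Proof.
have [relA _ univA] := hA; have [relB _ univB] := hB.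
have [t11 _ _] := relB; have [s11 _ _] := relA.
have q1 := normr_q_lt1 _ hq.
(* [x] is the future image of [s2] in [B]. *)
have [x xE] := twist_fixpoint q t1 (t2 * range_scale t1 (defect q)) q1 t11.
have [f [[fstar fs1 fs2] _]] := univA B t1 x (twist_relations _ hq _ _ _ relB xE).
have [g [[gstar gt1 gt2] _]] := univB A s1 _ (untwist_relations _ hq _ _ relA).
have morph_scale (C D : cstarAlgType R) (h : {lrmorphism C -> D}) t c :
    is_starhom h -> h (range_scale t c) = range_scale (h t) c.
  by move=> hs; rewrite rmorphD rmorph1 /= linearZ /= rmorphM /= hs.
(* Applying [g] to [xE] gives the equation that [untwist_fixpoint] gives for [s2], so the difference
   vanishes by [twist_eq0]. *)
have gx : g x = s2.
  apply/eqP; rewrite -subr_eq0; apply/eqP; apply: (twist_eq0 q s1) => //.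
  rewrite {1}xE {1}(untwist_fixpoint _ hq _ _ relA).
  rewrite rmorphD /= linearZ /= !rmorphM /= gt2.
  rewrite morph_scale // gstar gt1.
  by rewrite opprD addrACA subrr add0r -scalerBr -mulrBl -mulrBr.
exists f; split=> //; exists g.
  apply: (O2q_endo_id _ _ _ hA (g \o f)) => [a||] /=.
  - by rewrite fstar gstar.
  - by rewrite fs1.
  - by rewrite fs2.
apply: (O2q_endo_id _ _ _ hB (f \o g)) => [b||] /=.
- by rewrite gstar fstar.
- by rewrite gt1.
(* [f] carries [untwist q s1 s2] to [untwist q t1 x], which is [t2]. *)
rewrite gt2 /untwist !rmorphM /= !morph_scale // fs1 fs2.
exact: untwist_twist.
Qed.
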